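(* Let $p>3$ be a prime with $p\equiv 1\pmod 4$, and let $d$ be any integer with $p\nmid d$. Then $$\left(\frac{6S_{p-3}(d,p)}{p}\right)\neq -1.$$ Moreover, if $\left(\frac{d}{p}\right)=1$ and $p\equiv 5\pmod{12}$, then $$\left(\frac{S_{p-3}(d,p)}{p}\right)=(-1)^{(p+3)/4}.$$
   Context: $\left(\frac{\cdot}{p}\right)$ denotes the Legendre symbol (with value $0$ on multiples of $p$). For an odd prime $p$, an integer $d$ and a positive integer $m$, $S_m(d,p)$ denotes the integer $$S_m(d,p)=\det\left[(i^2+dj^2)^m\right]_{1\leqslant i,j\leqslant (p-1)/2}.$$ *)

(* Defs.v *)
From mathcomp Require Import all_boot all_order all_algebra.

Set Implicit Arguments.
Unset Strict Implicit.
Unset Printing Implicit Defensive.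

Import GRing.Theory Num.Theory.
Local Open Scope ring_scope.

(* Legendre symbol (a / p), meant for an odd prime p. *)
Definition legendre (a : int) (p : nat) : int :=
  if (p %| a)%Z then 0
  else if [exists x : 'I_p, ((x : nat)%:Z ^+ 2 == a %[mod p])%Z] then 1
  else -1.

(* The ordinals i, j start at 0, hence the shifts. *)
Definition S_det (m : nat) (d : int) (p : nat) : int :=
  \det (\matrix_(i < (p - 1) %/ 2, j < (p - 1) %/ 2)
          ((i.+1%:Z ^+ 2 + d * j.+1%:Z ^+ 2) ^+ m)).

(* Main.v *)
Require Import Defs.
From mathcomp Require Import all_boot all_order all_algebra.
From mathcomp Require Import all_field.
From mathcomp Require Import zify ring.

Set Implicit Arguments.
Unset Strict Implicit.
Unset Printing Implicit Defensive.

Import Order.TTheory GRing.Theory Num.Theory.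
Local Open Scope ring_scope.

(** Write [p = 2n + 1] with [n = 2(k + 1)], and work in ['F_p], where
    [x_i = i^2] satisfies [x_i^n = 1] and [d^n = eps] is [1] or [-1] according
    as [d] is a residue or not.  By Euler's criterion ([legendre_euler]) the
    Legendre symbol of [S = S_(p-3)(d,p)] is [S^n], so that [S] only matters up
    to squares; since [n] is even, signs are squares as well.

    In [(x_i + d x_j)^(2n-2)] the monomials [x_i^r] and [x_i^(n+r)] coincide.
    Folding the binomial expansion accordingly ([exprD_fold]) leaves [n]
    monomials, with coefficients
    [c_r = C(2n-2,r) + eps C(2n-2,n+r)], and exhibits the matrix as a product
    of a transposed Vandermonde matrix, the diagonal matrix of the [c_r] up to
    powers of [d], and the same Vandermonde matrix with reversed rows and
    rescaled columns.  The two Vandermonde determinants make a nonzero square,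
    hence [S] is zero exactly when some [c_r] is, and for a residue [d] it is
    the product of the [c_r] times a nonzero square.

    Now [2 C(p-3,m) = (-1)^m (m+1)(m+2)] modulo [p] and [2n = -1], so the [c_r]
    are explicit quadratic polynomials in [r] ([fold_coefE]).
    - If [eps = -1], then [8 c_r = (-1)^r (4r+5)] vanishes at [r = k], because
      [4k + 5 = p]; hence [S = 0].
    - If [eps = 1], then [16 c_r = (-1)^r ((4r+5)^2 - 3)].  The reflection
      [r -> 2k - r] changes [4r+5] into its opposite modulo [p].  It pairs all
      indices below [n] except the centre [k] and the last index [2k+1], where
      the quadratic takes the values [-3] and [-2].  So [S] is [6] times a
      square ([Fp_S_det_residue]).

    This rules out the value [-1] for [6 S].  When [p = 5] modulo [12], [3] is
    not a square, so no [c_r] vanishes, and [S] has the symbol of [6]; it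
    comes from [Fp_two_expr_half] and [Fp_three_expr_half]. *)

(** * Squares in a prime field and the Legendre symbol *)

Lemma natrFp_eq0 (p m : nat) (p_pr : prime p) :
  (m%:R == 0 :> 'F_p) = (p %| m)%N.
Proof. by rewrite (dvdn_pcharf (pchar_Fp p_pr)). Qed.

Lemma intrFp_eq0 (p : nat) (a : int) (p_pr : prime p) :
  (a%:~R == 0 :> 'F_p) = (p %| a)%Z.
Proof. by rewrite (dvdz_pcharf (pchar_Fp p_pr)). Qed.

Lemma natrFp_neq0 (p m : nat) (p_pr : prime p) :
  (0 < m < p)%N -> m%:R != 0 :> 'F_p.
Proof. by move=> /andP[m0 mp]; rewrite natrFp_eq0 // gtnNdvd. Qed.

Lemma Fp_expr_double_half (p n : nat) (p_pr : prime p) (pE : p = n.*2.+1)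
    (x : 'F_p) :
  x != 0 -> x ^+ n.*2 = 1.
Proof.
move=> x0; apply: (mulfI x0).
by rewrite mulr1 -exprS -pE -{2}[x]expf_card card_Fp.
Qed.

Lemma Fp_double_half (p n : nat) (p_pr : prime p) (pE : p = n.*2.+1) :
  2 * n%:R = -1 :> 'F_p.
Proof.
have /eqP : p%:R = 0 :> 'F_p by apply/eqP; rewrite natrFp_eq0.
by rewrite pE -natr1 addr_eq0 -mul2n natrM => /eqP.
Qed.

Lemma Fp_sqrS_inj (p n : nat) (p_pr : prime p) (pE : p = n.*2.+1) :
  {in gtn n &, injective (fun i : nat => i.+1%:R ^+ 2 : 'F_p)}.
Proof.
move=> i j; rewrite !inE => lt_in lt_jn /= /eqP.
rewrite eqf_sqr => /orP[/eqP eq_ij|].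
  wlog le_ij : i j lt_in lt_jn eq_ij / (i <= j)%N.
    by move=> IH; case/orP: (leq_total i j) => le; [|symmetry]; apply: IH.
  have /eqP : (j - i)%:R = 0 :> 'F_p.
    by rewrite -subSS natrB // eq_ij subrr.
  rewrite natrFp_eq0 //; case: (posnP (j - i)%N) => [|gt0 /dvdn_leq]; lia.
rewrite -addr_eq0 -natrD natrFp_eq0 // => /dvdn_leq; lia.
Qed.

(** The hard half of Euler's criterion: the [n] distinct squares of
    [1, ..., n] already exhaust the roots of ['X^n - 1].  The root is given
    by its least natural representative, the form in which [legendre] and the
    entries of the determinant speak of squares. *)
Lemma Fp_expr_half1 (p n : nat) (p_pr : prime p) (pE : p = n.*2.+1)
    (a : 'F_p) :
  a ^+ n = 1 -> exists2 i : nat, (i < n)%N & a = i.+1%:R ^+ 2.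
Proof.
move=> an1.
have n0 : (0 < n)%N by case: n pE p_pr {an1} => // ->.
pose s := [seq (i.+1%:R ^+ 2 : 'F_p) | i <- iota 0 n].
have [/mapP[i lt_in ->]|a_notin] := boolP (a \in s).
  by exists i => //; move: lt_in; rewrite mem_iota.
have : (size (a :: s) < size (('X^n - 1)%R : {poly 'F_p}))%N.
  apply: max_poly_roots; first by rewrite -size_poly_gt0 size_XnsubC.
    rewrite /= rootE !hornerE an1 subrr eqxx /=.
    apply/allP=> x /mapP[i]; rewrite mem_iota => /andP[_ lt_in] ->.
    rewrite rootE !hornerE -exprM mul2n (Fp_expr_double_half p_pr pE) ?subrr //.
    by apply: natrFp_neq0 => //; lia.
  rewrite /= a_notin map_inj_in_uniq ?iota_uniq // => i j.
  rewrite !mem_iota !add0n /= => lt_in lt_jn; exact: (Fp_sqrS_inj p_pr pE).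
by rewrite size_XnsubC //= size_map size_iota ltnn.
Qed.

Lemma Fp_expr_half_sign (p n : nat) (p_pr : prime p) (pE : p = n.*2.+1)
    (a : 'F_p) :
  a != 0 -> a ^+ n = 1 \/ a ^+ n = -1.
Proof.
move=> /(Fp_expr_double_half p_pr pE); rewrite -muln2 exprM => /eqP.
by rewrite sqrf_eq1 => /orP[]/eqP; [left|right].
Qed.

(** Euler's criterion makes the Legendre symbol multiplicative: every question
    about it below becomes a computation of [n]-th powers. *)
Lemma legendre_euler (p n : nat) (p_pr : prime p) (pE : p = n.*2.+1)
    (a : int) :
  (legendre a p)%:~R = a%:~R ^+ n :> 'F_p.
Proof.
have n0 : (0 < n)%N by case: n pE p_pr => // ->.
rewrite /legendre -intrFp_eq0 //.
have [->|a0] := eqVneq (a%:~R : 'F_p) 0; first by rewrite expr0n gtn_eqF.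
case: existsP => [[x]|no_root].
  rewrite eqz_mod_dvd -intrFp_eq0 // rmorphB rmorphXn subr_eq0 /= => /eqP xa.
  rewrite -xa -exprM mul2n (Fp_expr_double_half p_pr pE) //.
  by apply: contraNneq a0 => x0; rewrite -xa x0 expr0n.
case: (Fp_expr_half_sign p_pr pE a0) => [an1|-> //].
have [i lt_in aE] := Fp_expr_half1 p_pr pE an1.
have lt_ip : (i.+1 < p)%N by lia.
case: no_root; exists (Ordinal lt_ip).
by rewrite eqz_mod_dvd -intrFp_eq0 // rmorphB rmorphXn /= aE subrr.
Qed.

Lemma legendre_val (a : int) (p : nat) :
  [\/ legendre a p = 0, legendre a p = 1 | legendre a p = -1].
Proof.
rewrite /legendre; case: ifP => _; first by constructor 1.
by case: ifP => _; [constructor 2|constructor 3].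
Qed.

(** Gauss's argument for the quadratic character of 2: with [F = (2k)!], the
    product [2^(2k) F] is that of the even numbers up to [4k]; those above [2k]
    are the opposites modulo [p] of the odd numbers below [2k], which turns it
    into [(-1)^k F]. *)
Lemma Fp_two_expr_half (p k : nat) (p_pr : prime p)
    (pE : p = k.*2.*2.+1) :
  2 ^+ k.*2 = (-1) ^+ k :> 'F_p.
Proof.
pose F := \prod_(0 <= i < k.*2) i.+1%:R : 'F_p.
have F0 : F != 0.
  rewrite /F big_mkord; apply/prodf_neq0 => i _; apply: natrFp_neq0 => //.
  by have := ltn_ord i; lia.
apply: (mulIf F0).
have -> : 2 ^+ k.*2 * F = \prod_(0 <= i < k.*2) (i.+1.*2)%:R.
  rewrite /F !big_mkord -[in 2 ^+ _](card_ord k.*2) -prodr_const -big_split /=.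
  by apply: eq_bigr => i _; rewrite -natrM mul2n.
have splitF : F = \prod_(0 <= i < k) ((i.*2.+1)%:R * (i.+1.*2)%:R).
  rewrite /F; elim: (k) => [|m IH]; first by rewrite !big_geq.
  by rewrite doubleS !big_nat_recr //= IH mulrA.
rewrite (@big_cat_nat _ _ _ k) ?leq0n //=; last by lia.
rewrite splitF big_split /= mulrA [LHS]mulrC; congr (_ * _).
have -> : (-1 : 'F_p) ^+ k = \prod_(0 <= i < k) -1.
  by rewrite big_mkord prodr_const card_ord.
rewrite -big_split /= -{1}(add0n k) big_addn -addnn addnK big_nat_rev /= add0n.
rewrite !big_mkord; apply: eq_bigr => i _; have lt_ik := ltn_ord i.
apply/eqP; rewrite mulN1r -addr_eq0 -natrD natrFp_eq0 // pE.
by rewrite [X in (_ %| X)%N](_ : _ = k.*2.*2.+1) ?dvdnn //; lia.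
Qed.

(** Here [p - 1 = 3q + 1], so the inverse of [z] is a power of [z^3]. *)
Lemma Fp_cube_inj (p : nat) (p_pr : prime p) :
  p = 2 %[mod 3] -> injective (fun x : 'F_p => x ^+ 3).
Proof.
move=> p2 x y /= xy.
have [q pE] : exists q, p = (3 * q + 2)%N by exists (p %/ 3)%N; lia.
have cubeV (z : 'F_p) : z != 0 -> z * (z ^+ 3) ^+ q = 1.
  move=> z0; apply: (mulfI z0); rewrite mulr1 -exprM -!exprS.
  by rewrite (_ : _.+2 = p); [rewrite -{2}[z]expf_card card_Fp | lia].
have [y0|y0] := eqVneq y 0.
  by apply/eqP; move/eqP: xy; rewrite y0 expr0n /= expf_eq0.
have x0 : x != 0.
  by apply: contraNneq y0 => x0; move/esym/eqP: xy; rewrite x0 expr0n expf_eq0.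
have := cubeV x x0; rewrite xy -(cubeV y y0) => /mulIf; apply.
by rewrite !expf_neq0.
Qed.

(** As [p = 1] modulo [4], [-1] is a square; were [3] one too, [-3 = s^2] would
    give the nontrivial cube root of unity [(s - 1) / 2], which cannot exist
    because [p = 2] modulo [3]. *)
Lemma Fp_three_expr_half (p n : nat) (p_pr : prime p) (pE : p = n.*2.+1) :
  p = 5 %[mod 12] -> 3 ^+ n = -1 :> 'F_p.
Proof.
move=> p5.
have three0 : 3 != 0 :> 'F_p by apply: natrFp_neq0 => //; lia.
have [/(Fp_expr_half1 p_pr pE)[i _ sq3]|//] := Fp_expr_half_sign p_pr pE three0.
have [|j _ sqN1] := Fp_expr_half1 p_pr pE (a := -1).
  by rewrite -signr_odd (_ : odd n = false) //; lia.
pose s : 'F_p := i.+1%:R * j.+1%:R.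
have s2 : s ^+ 2 = -3 by rewrite exprMn -sq3 -sqN1 mulrN1.
have p2 : p = 2 %[mod 3] by lia.
(* Clearing denominators: [(s - 1)^3 = 2^3] must force [s - 1 = 2]. *)
have : s - 1 = 2.
  apply: (Fp_cube_inj p_pr p2).
  have -> : (s - 1) ^+ 3 = s * s ^+ 2 - 3 * s ^+ 2 + 3 * s - 1 by ring.
  by rewrite s2; ring.
move=> /(canRL (subrK _)) sE.
have : 12%:R = 0 :> 'F_p.
  by have -> : 12%:R = s ^+ 2 + 3 :> 'F_p; [rewrite sE; ring | rewrite s2 addNr].
move/eqP; rewrite natrFp_eq0 // => p_dvd12.
have := dvdn_leq (isT : (0 < 12)%N) p_dvd12.
have [p_eq5|] : p = 5 \/ (12 < p)%N by lia.
  by move: p_dvd12; rewrite p_eq5.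
by lia.
Qed.

(** * Factoring the determinant through Vandermonde matrices *)

(** The matrix is [V^T D V'], with [V] the Vandermonde matrix of [x], [D] the
    diagonal matrix of [c], and [V'] equal to [V] with its rows reversed and
    its columns scaled by the [x_j^e]. *)
Lemma det_weighted_vandermonde (R : comNzRingType) (n e : nat) (x c : 'rV[R]_n) :
  \det (\matrix_(i < n, j < n)
          \sum_(r < n) c 0 r * x 0 i ^+ r * x 0 j ^+ (e + rev_ord r)) =
  (-1) ^+ perm.odd_perm (perm.perm (@rev_ord_inj n)) *
  (\prod_r c 0 r) * (\prod_j x 0 j ^+ e) * \det (Vandermonde n x) ^+ 2.
Proof.
set V := Vandermonde n x; set s := perm.perm _.
rewrite (_ : \matrix_(i, j) _ =
    V^T *m diag_mx c *m row_perm s V *m diag_mx (\row_j x 0 j ^+ e)).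
  rewrite !det_mulmx det_tr !det_diag row_permE det_mulmx det_perm.
  under [X in _ * X = _]eq_bigr do rewrite mxE.
  by move: (\det V) (_ ^+ _) (\prod_r _) (\prod_j _) => v sg C E; ring.
apply/matrixP => i j; rewrite mul_mx_diag !mxE big_distrl /=.
apply: eq_bigr => r _; rewrite mul_mx_diag !mxE perm.permE exprD; ring.
Qed.

(** When [x^n = 1] and [y^n = eps = eps^-1], this is the coefficient of
    [x^r y^(2n-2-r)] in [(x + y)^(2n-2)]: the terms of index [r] and [n + r] of
    the binomial formula are merged. *)
Definition fold_coef (R : comNzRingType) (n r : nat) (eps : R) : R :=
  'C(n.*2 - 2, r)%:R + eps * 'C(n.*2 - 2, n + r)%:R.

(** The exponent [2n - 2 - r] of [y] is written [n.-1 + rev_ord r], as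
    [det_weighted_vandermonde] wants it. *)
Lemma exprD_fold (R : comNzRingType) (n : nat) (x y eps : R) :
  (0 < n)%N -> x ^+ n = 1 -> y ^+ n = eps -> eps ^+ 2 = 1 ->
  (x + y) ^+ (n.*2 - 2) =
  \sum_(r < n) fold_coef n r eps * x ^+ r * y ^+ (n.-1 + rev_ord r).
Proof.
rewrite /fold_coef =>  n0 xn yn eps2; set N := (n.*2 - 2)%N.
(* The extra index [2n - 1] has a null binomial coefficient and makes the range
   split into two halves of length [n]. *)
have -> : (x + y) ^+ N =
          \sum_(0 <= m < n.*2) 'C(N, m)%:R * x ^+ m * y ^+ (N - m).
  rewrite (_ : n.*2 = N.+2); last by rewrite /N; lia.
  rewrite big_nat_recr //= bin_small // mul0r mul0r addr0 addrC exprDn big_mkord.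
  by apply: eq_bigr => m _; rewrite -mulr_natl; ring.
rewrite (@big_cat_nat _ _ _ n) //=; last by lia.
rewrite -[X in index_iota X n.*2]add0n big_addn -addnn addnK.
rewrite !big_mkord -big_split /=.
apply: eq_bigr => r _; have lt_rn := ltn_ord r.
have -> : (n.-1 + (n - r.+1) = N - r)%N by rewrite /N; lia.
rewrite [(r + n)%N]addnC 2!mulrDl; congr (_ + _).
(* The subtraction [N - (n + r)] is truncated only for [r = n - 1], where the
   coefficient is null. *)
have [lt_N|le_N] := ltnP N (n + r); first by rewrite bin_small // mulr0 !mul0r.
have -> : (N - r = n + (N - (n + r)))%N by lia.
rewrite !exprD xn yn mul1r; set X := x ^+ r; set Y := y ^+ _.
by rewrite -[LHS]mul1r -eps2; ring.
Qed.

Lemma Fp_vandermonde_squares_neq0 (p n : nat) (p_pr : prime p)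
    (pE : p = n.*2.+1) :
  \det (Vandermonde n (\row_(j < n) (j.+1%:R ^+ 2 : 'F_p))) != 0.
Proof.
rewrite det_Vandermonde; apply/prodf_neq0 => i _; apply/prodf_neq0 => j lt_ij.
rewrite !mxE subr_eq0; apply: contraTneq lt_ij => sq_ij.
by rewrite (Fp_sqrS_inj p_pr pE _ _ sq_ij) ?inE ?ltn_ord // ltnn.
Qed.

(** The factorization behind the whole proof: apart from the [fold_coef], all
    factors are nonzero, and for even [n] they are squares when [d] is one. *)
Lemma Fp_S_detE (p n : nat) (d : int) (p_pr : prime p) (pE : p = n.*2.+1) :
  d%:~R != 0 :> 'F_p ->
  (S_det (p - 3) d p)%:~R =
  (-1) ^+ perm.odd_perm (perm.perm (@rev_ord_inj n)) *
  (\prod_(r < n) (fold_coef n r (d%:~R ^+ n) * d%:~R ^+ (n.-1 + rev_ord r))) *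
  (\prod_(j < n) (j.+1%:R ^+ 2) ^+ n.-1) *
  \det (Vandermonde n (\row_(j < n) (j.+1%:R ^+ 2))) ^+ 2 :> 'F_p.
Proof.
move=> d0.
have n0 : (0 < n)%N by case: n pE p_pr => // ->.
have sqn (i : 'I_n) : (i.+1%:R ^+ 2) ^+ n = 1 :> 'F_p.
  rewrite -exprM mul2n (Fp_expr_double_half p_pr pE) //.
  by apply: natrFp_neq0 => //; have := ltn_ord i; lia.
pose c : 'rV['F_p]_n :=
  \row_r (fold_coef n r (d%:~R ^+ n) * d%:~R ^+ (n.-1 + rev_ord r)).
have := det_weighted_vandermonde n.-1 (\row_j (j.+1%:R ^+ 2)) c.
under [X in _ * X * _ * _]eq_bigr do rewrite mxE.
under [X in _ * X * _]eq_bigr do rewrite mxE.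
move <-; rewrite /S_det (_ : ((p - 1) %/ 2)%N = n); last by lia.
rewrite -(det_map_mx (intmul 1 : {rmorphism int -> 'F_p})); congr (\det _).
apply/matrixP => i j; rewrite !mxE /= rmorphXn rmorphD rmorphM !rmorphXn /=.
rewrite (_ : p - 3 = n.*2 - 2)%N; last by lia.
rewrite -!pmulrn (@exprD_fold _ n _ _ (d%:~R ^+ n)) ?(exprMn _ d%:~R) ?sqn;
  rewrite ?mulr1 //.
  by apply: eq_bigr => r _; rewrite !mxE (exprMn _ d%:~R) mulrACA mulrA.
by rewrite -exprM muln2 (Fp_expr_double_half p_pr pE).
Qed.

Lemma Fp_S_det_expr_half (p n : nat) (d : int) (p_pr : prime p)
    (pE : p = n.*2.+1) :
  ~~ odd n -> d%:~R ^+ n = 1 :> 'F_p ->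
  (S_det (p - 3) d p)%:~R ^+ n = \prod_(r < n) fold_coef n r 1 ^+ n :> 'F_p.
Proof.
move=> even_n dn.
have n0 : (0 < n)%N by case: n pE p_pr {even_n dn} => // ->.
have d0 : d%:~R != 0 :> 'F_p.
  by apply: contra_eq_neq dn => ->; rewrite expr0n gtn_eqF // eq_sym oner_neq0.
rewrite (Fp_S_detE p_pr pE d0) dn.
move: (Fp_vandermonde_squares_neq0 p_pr pE) (perm.odd_perm _).
move: (\det _) => v v0 b.
rewrite exprMn -(exprM v) mul2n (Fp_expr_double_half p_pr pE v0) mulr1.
rewrite 2!exprMn exprAC -[X in X ^+ b]signr_odd (negbTE even_n) expr1n mul1r.
rewrite -!prodrXl [X in _ * X]big1 ?mulr1 => [|j _].
  by apply: eq_bigr => r _; rewrite exprMn [X in _ * X]exprAC dn expr1n mulr1.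
rewrite (exprAC _ n.-1 n) -(exprM _ 2) mul2n (Fp_expr_double_half p_pr pE).
  by rewrite expr1n.
by apply: natrFp_neq0 => //; have := ltn_ord j; lia.
Qed.

(** * Evaluating the folded binomial coefficients *)

(** The upper entry [p - 3] acts as [-3], and [C(-3, m)] is
    [(-1)^m C(m + 2, 2)]; the formula reaches [m = p - 2], where both sides
    vanish, and this covers the truncated end of [fold_coef]. *)
Lemma Fp_bin_subr3 (p m : nat) (p_pr : prime p) :
  (2 < p)%N -> (m.+1 < p)%N ->
  2 * 'C(p - 3, m)%:R = (-1) ^+ m * m.+1%:R * m.+2%:R :> 'F_p.
Proof.
move=> p_gt2; elim: m => [|m IH] lt_mp; first by rewrite bin0; ring.
have m0 : m.+1%:R != 0 :> 'F_p by apply: natrFp_neq0 => //; lia.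
apply: (mulfI m0); rewrite mulrCA -natrM mul_bin_left natrM.
have -> : (p - 3 - m)%:R = - m.+3%:R :> 'F_p.
  apply/eqP; rewrite -addr_eq0 -natrD natrFp_eq0 //.
  by rewrite (_ : _ + _ = p)%N //; lia.
by rewrite mulrCA IH; [rewrite exprS; ring | lia].
Qed.

Lemma fold_coefE (p n r : nat) (eps : 'F_p) (p_pr : prime p)
    (pE : p = n.*2.+1) :
  (1 < n)%N -> ~~ odd n -> (r < n)%N ->
  8 * fold_coef n r eps =
  (-1) ^+ r * (4 * r.+1%:R * r.+2%:R + eps * (2 * r%:R + 1) * (2 * r%:R + 3)).
Proof.
move=> n_gt1 even_n lt_rn; have n2 := Fp_double_half p_pr pE.
have NE : (n.*2 - 2 = p - 3)%N by lia.
have C1 : 2 * 'C(n.*2 - 2, r)%:R = (-1) ^+ r * r.+1%:R * r.+2%:R :> 'F_p.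
  by rewrite NE Fp_bin_subr3 //; lia.
have C2 : 2 * 'C(n.*2 - 2, n + r)%:R =
          (-1) ^+ r * (n + r).+1%:R * (n + r).+2%:R :> 'F_p.
  rewrite NE Fp_bin_subr3 ?exprD -1?[_ ^+ n]signr_odd ?(negbTE even_n) ?mul1r //.
    lia.
  lia.
rewrite /fold_coef.
transitivity (4 * (2 * 'C(n.*2 - 2, r)%:R) +
              4 * eps * (2 * 'C(n.*2 - 2, n + r)%:R) : 'F_p); first by ring.
rewrite C1 C2 -(natr1 (n + r).+1) -(natr1 (n + r)) natrD.
transitivity ((-1) ^+ r * (4 * r.+1%:R * r.+2%:R +
   eps * (2 * r%:R + 2 * n%:R + 2) * (2 * r%:R + 2 * n%:R + 4)) : 'F_p).
  by ring.
by rewrite n2; ring.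
Qed.

(** The reflection [r -> 2k - r] fixes [k] and pairs the other indices up to
    [2k], leaving out the last one, [2k + 1]. *)
Lemma prod_reflection_square (R : comNzRingType) (k : nat) (g : nat -> R) :
  (forall r, (r < k)%N -> g (k.*2 - r)%N = g r) ->
  \prod_(r < k.+1.*2) g r = (\prod_(r < k) g r) ^+ 2 * g k * g k.*2.+1.
Proof.
move=> g_refl; rewrite -!(big_mkord xpredT) doubleS big_nat_recr //=.
congr (_ * _).
rewrite (@big_cat_nat _ _ _ k) //=; last by lia.
rewrite [X in _ * X]big_ltn; last by lia.
rewrite -[X in index_iota X k.*2.+1]add0n big_addn.
rewrite (_ : k.*2.+1 - k.+1 = k)%N; last by lia.
rewrite (_ : \prod_(0 <= i < k) g (i + k.+1)%N = \prod_(0 <= r < k) g r).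
  by rewrite expr2 mulrCA mulrC.
rewrite big_nat_rev /= add0n !big_mkord; apply: eq_bigr => i _.
have lt_ik := ltn_ord i; rewrite -(g_refl i) //; congr g; lia.
Qed.

(** The coefficient of index [k] is [4k + 5 = p = 0] up to a unit. *)
Lemma Fp_S_det_nonresidue (p k : nat) (d : int) (p_pr : prime p)
    (pE : p = k.+1.*2.*2.+1) :
  d%:~R ^+ k.+1.*2 = -1 :> 'F_p -> (S_det (p - 3) d p)%:~R = 0 :> 'F_p.
Proof.
move=> dn.
have d0 : d%:~R != 0 :> 'F_p.
  by apply: contra_eq_neq dn => ->; rewrite expr0n /= eq_sym oppr_eq0 oner_neq0.
have eight0 : 8 != 0 :> 'F_p.
  by rewrite (natrX _ 2 3) expf_neq0 //; apply: natrFp_neq0 => //; lia.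
have lt_kn : (k < k.+1.*2)%N by lia.
have ck0 : fold_coef k.+1.*2 k (-1) = 0 :> 'F_p.
  apply: (mulfI eight0); rewrite mulr0 (fold_coefE _ p_pr) ?odd_double //.
  have p0 : p%:R = 0 :> 'F_p by apply/eqP; rewrite natrFp_eq0.
  transitivity ((-1) ^+ k * p%:R : 'F_p); last by rewrite p0 mulr0.
  rewrite pE; rewrite (_ : k.+1.*2.*2.+1 = 4 * k + 5)%N; last by lia.
  by rewrite natrD natrM; ring.
rewrite (Fp_S_detE p_pr pE d0) dn (bigD1 (Ordinal lt_kn)) //= ck0.
by rewrite !(mul0r, mulr0).
Qed.

(** The last factor [6] is the product of the values [-3] and [-2] at the two
    indices that the reflection does not pair; raising to the power [n] hides
    the square factors [16] and the signs. *)
Lemma Fp_S_det_residue (p k : nat) (d : int) (p_pr : prime p)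
    (pE : p = k.+1.*2.*2.+1) :
  d%:~R ^+ k.+1.*2 = 1 :> 'F_p ->
  (S_det (p - 3) d p)%:~R ^+ k.+1.*2 =
  ((\prod_(r < k) ((4 * r%:R + 5) ^+ 2 - 3)) ^+ 2 * 6) ^+ k.+1.*2 :> 'F_p.
Proof.
move=> dn; rewrite (Fp_S_det_expr_half p_pr pE) ?odd_double // prodrXl.
pose g (r : nat) : 'F_p := (4 * r%:R + 5) ^+ 2 - 3.
have p0 : p%:R = 0 :> 'F_p by apply/eqP; rewrite natrFp_eq0.
have k4 : 4 * k%:R + 5 = 0 :> 'F_p.
  rewrite -p0 pE (_ : k.+1.*2.*2.+1 = 4 * k + 5)%N; last by lia.
  by rewrite natrD natrM.
have cE (r : 'I_k.+1.*2) : 16 * fold_coef k.+1.*2 r 1 = (-1) ^+ r * g r :> 'F_p.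
  rewrite (natrM _ 2 8) -mulrA.
  by rewrite (fold_coefE _ p_pr pE) ?odd_double // /g; ring.
have -> : (\prod_(r < k) ((4 * r%:R + 5) ^+ 2 - 3)) ^+ 2 * 6 =
          \prod_(r < k.+1.*2) g r.
  rewrite (prod_reflection_square (g := g)) => [|r lt_rk]; last first.
    rewrite /g natrB -?muln2 ?natrM; last by lia.
    rewrite (_ : 4 * _ + 5 = 2 * (4 * k%:R + 5) - (4 * r%:R + 5)); last by ring.
    by rewrite k4 mulr0 sub0r sqrrN.
  rewrite -mulrA; congr (_ * _); rewrite /g k4 -muln2 -(natr1 (k * 2)) natrM.
  rewrite (_ : 4 * _ + 5 = 2 * (4 * k%:R + 5) - 1); last by ring.
  by rewrite k4; ring.
rewrite -!prodrXl; apply: eq_bigr => r _.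
have four0 : 4 != 0 :> 'F_p by apply: natrFp_neq0 => //; lia.
have <- : 16 ^+ k.+1.*2 * fold_coef k.+1.*2 r 1 ^+ k.+1.*2 =
          fold_coef k.+1.*2 r 1 ^+ k.+1.*2 :> 'F_p.
  by rewrite (natrX _ 4 2) -exprM mul2n (Fp_expr_double_half p_pr pE) ?mul1r.
rewrite -exprMn cE exprMn exprAC -[X in X ^+ r]signr_odd odd_double expr1n.
by rewrite mul1r.
Qed.

Lemma Fp_one_neqN1 (p : nat) (p_pr : prime p) (p_gt2 : (2 < p)%N) :
  1 != -1 :> 'F_p.
Proof. by rewrite -addr_eq0 -(natrD _ 1 1) natrFp_neq0. Qed.

Theorem theorem1p4 (p : nat) (d : int) (p_prime : prime p) (p_gt3 : (3 < p)%N)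
    (p_mod4 : p = 1 %[mod 4]) (p_ndvd_d : ~~ (p %| d)%Z) :
  legendre (6 * S_det (p - 3) d p) p <> -1 /\
  (legendre d p = 1 -> p = 5 %[mod 12] ->
   legendre (S_det (p - 3) d p) p = (-1) ^+ ((p + 3) %/ 4)).
Proof.
have [k pE] : exists k, p = k.+1.*2.*2.+1 by exists (p %/ 4).-1; lia.
have d0 : d%:~R != 0 :> 'F_p by rewrite intrFp_eq0.
have six0 : 6 != 0 :> 'F_p.
  by rewrite (natrM _ 2 3) mulf_neq0 //; apply: natrFp_neq0 => //; lia.
have one_neqN1 := Fp_one_neqN1 p_prime (ltnW p_gt3).
have euler := legendre_euler p_prime pE.
split.
  move=> leg; have := euler (6 * S_det (p - 3) d p).
  rewrite leg rmorphM rmorph_nat /=.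
  have [dn|dn] := Fp_expr_half_sign p_prime pE d0; last first.
    rewrite (Fp_S_det_nonresidue p_prime pE dn) mulr0 expr0n /= => /eqP.
    by rewrite oppr_eq0 oner_eq0.
  rewrite exprMn (Fp_S_det_residue p_prime pE dn) -exprMn.
  move: (\prod_(r < k) _) => t.
  have -> : 6 * (t ^+ 2 * 6) = (6 * t) ^+ 2 by ring.
  rewrite -exprM mul2n; have [->|t0] := eqVneq t 0.
    by rewrite mulr0 expr0n /= => /eqP; rewrite oppr_eq0 oner_eq0.
  rewrite (Fp_expr_double_half p_prime pE) ?mulf_neq0 // => /esym/eqP.
  by rewrite (negbTE one_neqN1).
move=> leg_d p5.
have dn : d%:~R ^+ k.+1.*2 = 1 :> 'F_p by rewrite -euler leg_d.
have := euler (S_det (p - 3) d p); rewrite (Fp_S_det_residue p_prime pE dn).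
have three := Fp_three_expr_half p_prime pE p5.
have t0 : \prod_(r < k) ((4 * r%:R + 5) ^+ 2 - 3) != 0 :> 'F_p.
  apply/prodf_neq0 => r _; rewrite subr_eq0.
  apply: contra_eq_neq three => sq3; rewrite -sq3 -exprM mul2n.
  rewrite (Fp_expr_double_half p_prime pE) //.
  have three0 : 3 != 0 :> 'F_p by apply: natrFp_neq0.
  by apply: contraNneq three0 => sq0; rewrite -sq3 sq0 expr0n.
rewrite exprMn -exprM mul2n (Fp_expr_double_half p_prime pE t0) mul1r.
rewrite (natrM _ 2 3) exprMn three (Fp_two_expr_half p_prime pE) -exprSr.
rewrite (_ : ((p + 3) %/ 4 = k.+2)%N); last by lia.
rewrite -(signr_odd 'F_p k.+2) -(signr_odd int k.+2).
have N1 : (-1 == 0 :> 'F_p) = false by rewrite oppr_eq0 oner_eq0.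
case: (odd k.+2); case: (legendre_val (S_det (p - 3) d p) p) => -> //= /eqP.
- by rewrite eq_sym N1.
- by rewrite (negbTE one_neqN1).
- by rewrite eq_sym (negbTE one_neqN1).
Qed.
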